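(* Let $T$ be a complete countable first-order theory, $\mathcal{B}$ a complete Boolean algebra, $I$ an index set, $\mathbf{A}$ an $I$-distribution in $\mathcal{B}$, and $\overline{\varphi}=(\varphi_i(\overline{x},\overline{y}_i):i\in I)$ an $I$-sequence of formulas. The following are equivalent: (A) $\mathbf{A}$ is an $(I,T,\overline{\varphi})$-possibility. (B) For every $s\in[I]^{<\aleph_0}$ and every $\mathbf{c}\in\mathcal{B}_+$ such that $\mathbf{c}$ decides $\mathbf{A}(t)$ for all $t\subseteq s$ and $\mathbf{c}\le\mathbf{A}(\{i\})$ for all $i\in s$, there is $M\models T$ and a sequence $(\overline{a}_i:i\in s)$ of tuples from $M$ (with $|\overline{a}_i|=|\overline{y}_i|$) such that for each $t\subseteq s$, $M\models\exists\overline{x}\bigwedge_{i\in t}\varphi_i(\overline{x},\overline{a}_i)$ if and only if $\mathbf{c}\le\mathbf{A}(t)$.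
   Context: $\mathcal{B}_+$ is the set of nonzero elements; nonzero $\mathbf{c}$ decides $\mathbf{b}$ if $\mathbf{c}\le\mathbf{b}$ or $\mathbf{c}\le\neg\mathbf{b}$. An $I$-distribution is $\mathbf{A}:[I]^{<\aleph_0}\to\mathcal{B}_+$ with $\mathbf{A}(\emptyset)=1$, decreasing under inclusion; multiplicative if $\mathbf{A}(s)=\bigwedge_{i\in s}\mathbf{A}(\{i\})$. $\mathbf{B}$ conservatively refines $\mathbf{A}$ if $\mathbf{B}(s)=\mathbf{A}(s)\wedge\mathbf{C}(s)$ for all $s$ for some multiplicative $I$-distribution $\mathbf{C}$. An $I$-sequence of formulas is $(\varphi_i(\overline{x},\overline{y}_i):i\in I)$ with the $\overline{y}_i$ pairwise disjoint and disjoint from $\overline{x}$. $\mathbf{M}\models^{\mathcal{B}}T$ means $\mathbf{M}$ is a set with $\|\cdot\|_{\mathbf{M}}$ from formulas with parameters in $\mathbf{M}$ to $\mathcal{B}$ such that valid sentences get $1$, $\|\neg\varphi\|=\neg\|\varphi\|$, $\|\varphi\wedge\psi\|=\|\varphi\|\wedge\|\psi\|$, $\|\exists x\varphi(x)\|=\bigvee_a\|\varphi(a)\|$, $\|a=b\|<1$ for distinct $a,b$, each $\|\exists x\varphi(x)\|$ is attained as some $\|\varphi(a)\|$, and $\|\varphi\|=1$ for $\varphi\in T$. $\mathbf{A}$ is an $(I,T,\overline{\varphi})$-Łoś map if there are $\mathbf{M}\models^{\mathcal{B}}T$ and $\overline{a}_i\in\mathbf{M}^{|\overline{y}_i|}$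 with $\mathbf{A}(s)=\|\exists\overline{x}\bigwedge_{i\in s}\varphi_i(\overline{x},\overline{a}_i)\|_{\mathbf{M}}$ for all $s$. $\mathbf{A}$ is an $(I,T,\overline{\varphi})$-possibility if it is a conservative refinement of some $(I,T,\overline{\varphi})$-Łoś map. *)

(* Defs.v *)
From HB Require Import structures.
From mathcomp Require Import all_boot all_order finmap.
From mathcomp Require Import boolp classical_sets functions cardinality.

Set Implicit Arguments.
Unset Strict Implicit.
Unset Printing Implicit Defensive.

Import Order.TTheory.

(** * First-order logic *)

Record language := Language {
  funsym : Type;
  fun_arity : funsym -> nat;
  relsym : Type;
  rel_arity : relsym -> nat }.

Definition countable_language (L : language) : Prop :=
  countable [set: funsym L] /\ countable [set: relsym L].

(* [formula L V] is the type of first-order L-formulas whose free names are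
   taken from V; a quantifier binds the name [None] of [option V].  The names
   may be read as variables or as parameters: [formula L void] is the type of
   L-sentences, and for a set M the type [formula L M] is L(M), the L-formulas
   all of whose free variables have been replaced by parameters from M. *)
Inductive term (L : language) (V : Type) : Type :=
| tvar of V
| tapp (f : funsym L) of ('I_(fun_arity f) -> term L V).

Inductive formula (L : language) (V : Type) : Type :=
| f_true
| f_eq of term L V & term L V
| f_rel (r : relsym L) of ('I_(rel_arity r) -> term L V)
| f_not of formula L V
| f_and of formula L V & formula L V
| f_ex of formula L (option V).

Arguments tvar {L V} _.
Arguments tapp {L V} f _.
Arguments f_true {L V}.
Arguments f_eq {L V} _ _.
Arguments f_rel {L V} r _.
Arguments f_not {L V} _.
Arguments f_and {L V} _ _.
Arguments f_ex {L V} _.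

Fixpoint term_map (L : language) (V W : Type) (h : V -> W) (t : term L V) :
    term L W :=
  match t with
  | tvar v => tvar (h v)
  | tapp f ts => tapp f (fun k => term_map h (ts k))
  end.

(* Simultaneous substitution of names for names; capture cannot occur since
   bound names live in the added point of [option]. *)
Fixpoint formula_map (L : language) (V W : Type) (h : V -> W)
    (p : formula L V) : formula L W :=
  match p with
  | f_true => f_true
  | f_eq t u => f_eq (term_map h t) (term_map h u)
  | f_rel r ts => f_rel r (fun k => term_map h (ts k))
  | f_not q => f_not (formula_map h q)
  | f_and q r => f_and (formula_map h q) (formula_map h r)
  | f_ex q => f_ex (formula_map (omap h) q)
  end.

(* phi(a), where x is the variable bound in [f_ex phi]. *)
Definition f_inst (L : language) (V : Type) (p : formula L (option V)) (a : V) :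
    formula L V :=
  formula_map (odflt a) p.

(* Existential quantification over a tuple x_0, ..., x_(n-1). *)
Fixpoint f_exs (L : language) (n : nat) (V : Type) :
    formula L ('I_n + V) -> formula L V :=
  match n with
  | 0 => formula_map (fun u : 'I_0 + V =>
           match u with
           | inl i => match notF (ltn_ord i) with end
           | inr v => v
           end)
  | n'.+1 => fun p => f_exs (f_ex (formula_map (fun u : 'I_n'.+1 + V =>
           match u with
           | inl i => omap inl (unlift ord0 i)
           | inr v => Some (inr v)
           end) p))
  end.

Record structure (L : language) := Structure {
  carrier :> Type;
  carrier_inh : inhabited carrier;
  finterp : forall f : funsym L, ('I_(fun_arity f) -> carrier) -> carrier;
  rinterp : forall r : relsym L, ('I_(rel_arity r) -> carrier) -> Prop }.

Fixpoint teval (L : language) (M : structure L) (V : Type) (e : V -> M)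
    (t : term L V) : M :=
  match t with
  | tvar v => e v
  | tapp f ts => finterp (fun k => teval e (ts k))
  end.

Fixpoint sat (L : language) (M : structure L) (V : Type) (e : V -> M)
    (p : formula L V) : Prop :=
  match p with
  | f_true => True
  | f_eq t u => teval e t = teval e u
  | f_rel r ts => rinterp (fun k => teval e (ts k))
  | f_not q => ~ sat e q
  | f_and q r => sat e q /\ sat e r
  | f_ex q => exists a : M, sat (fun o => if o is Some v then e v else a) q
  end.

(* M |= phi, for phi a formula with parameters in M. *)
Definition holds (L : language) (M : structure L) (p : formula L M) : Prop :=
  sat id p.

(* A sentence with parameters in V is valid when it is true in every structure
   under every interpretation of the parameters. *)
Definition valid (L : language) (V : Type) (p : formula L V) : Prop :=
  forall (M : structure L) (e : V -> M), sat e p.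

Definition theory (L : language) := set (formula L void).

Definition models (L : language) (M : structure L) (T : theory L) : Prop :=
  forall p, T p -> sat (of_void M) p.

Definition entails (L : language) (T : theory L) (p : formula L void) : Prop :=
  forall M : structure L, models M T -> sat (of_void M) p.

Definition complete_theory (L : language) (T : theory L) : Prop :=
  (exists M : structure L, models M T) /\
  (forall p, entails T p \/ entails T (f_not p)).

(* The pairwise disjointness of the tuples x, y_i (i in I) is built in: the
   formula phi_i has its own names for y_i, disjoint from those for x. *)
Record formula_seq (L : language) (I : Type) := FormulaSeq {
  xlen : nat;
  ylen : I -> nat;
  fseq_at :> forall i : I, formula L ('I_xlen + 'I_(ylen i)) }.

(* The formula "exists x, /\_(i in s) phi_i(x, a_i)".  Only the tuples a_i with
   i in s occur in it; as carriers are nonempty, asking for a family over all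
   of I is the same as asking for a family over s. *)
Definition ex_conj (L : language) (I : choiceType) (phi : formula_seq L I)
    (V : Type) (a : forall i, (ylen phi i).-tuple V) (s : {fset I}) :
    formula L V :=
  f_exs (\big[f_and/f_true]_(i <- s)
    formula_map (fun u : 'I_(xlen phi) + 'I_(ylen phi i) =>
      match u with
      | inl j => inl j
      | inr k => inr (tnth (a i) k)
      end) (phi i)).

(** * Boolean algebras and distributions *)

Local Open Scope order_scope.

Definition complete_lattice d (B : ctbDistrLatticeType d) : Prop :=
  forall S : set B, exists b, supremums S b.

Definition decides d (B : ctbDistrLatticeType d) (c b : B) : Prop :=
  (\bot < c) /\ (c <= b \/ c <= ~` b).

Record distribution d (B : ctbDistrLatticeType d) (I : choiceType) :=
  Distribution {
    dist_fun :> {fset I} -> B;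
    dist_pos : forall s, \bot < dist_fun s;
    dist0 : dist_fun fset0 = \top;
    dist_anti : forall s t, (s `<=` t)%fset -> dist_fun t <= dist_fun s }.

Definition multiplicative d (B : ctbDistrLatticeType d) (I : choiceType)
    (A : distribution B I) : Prop :=
  forall s, A s = \meet_(i <- s) A [fset i]%fset.

Definition conservatively_refines d (B : ctbDistrLatticeType d)
    (I : choiceType) (A' A : distribution B I) : Prop :=
  exists2 C : distribution B I,
    multiplicative C & forall s, A' s = A s `&` C s.

(** * Boolean-valued models *)

Record bv_structure d (B : ctbDistrLatticeType d) (L : language) :=
  BVStructure {
    bv_carrier :> Type;
    bv_val : formula L bv_carrier -> B;
    bv_valid : forall p, valid p -> bv_val p = \top;
    bv_not : forall p, bv_val (f_not p) = ~` (bv_val p);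
    bv_and : forall p q, bv_val (f_and p q) = bv_val p `&` bv_val q;
    bv_ex : forall p, supremums (range (fun a => bv_val (f_inst p a)))
                                (bv_val (f_ex p));
    bv_neq : forall a b, a <> b -> bv_val (f_eq (tvar a) (tvar b)) < \top;
    bv_full : forall p, exists a, bv_val (f_ex p) = bv_val (f_inst p a) }.

Definition bv_models d (B : ctbDistrLatticeType d) (L : language)
    (M : bv_structure B L) (T : theory L) : Prop :=
  forall p, T p -> bv_val (formula_map (of_void M) p) = \top.

Definition los_map d (B : ctbDistrLatticeType d) (I : choiceType)
    (L : language) (T : theory L) (phi : formula_seq L I)
    (A : distribution B I) : Prop :=
  exists (M : bv_structure B L) (a : forall i, (ylen phi i).-tuple M),
    bv_models M T /\ forall s, A s = bv_val (ex_conj a s).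

Definition possibility d (B : ctbDistrLatticeType d) (I : choiceType)
    (L : language) (T : theory L) (phi : formula_seq L I)
    (A : distribution B I) : Prop :=
  exists2 A0 : distribution B I,
    los_map T phi A0 & conservatively_refines A A0.

(* Main.v *)
Require Import Defs.
From mathcomp Require Import all_boot all_order finmap.
From mathcomp Require Import boolp classical_sets functions cardinality.
Import Order.Theory.

(** From a possibility, a given c > 0 lies in an ultrafilter of B; the quotient
    of the Boolean-valued structure by it is a two-valued model, in which the
    truth of each formula decided by c is the decided one.

    Conversely, take the models M_k provided by (B) for all pairs k = (s, c).
    Their full product is a Boolean-valued model over the powerset of the set K
    of these pairs, so any Boolean homomorphism h from that powerset to B turns
    it into a B-valued model.  If S t is the set of those k for which M_k
    satisfies the formula of t, it suffices that
      A t <= h (S t)  and  h (S t) /\ C t <= A t,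
    where C t is the meet of the A {i}, i in t.  These bounds define a
    meet-preserving map, and a maximal meet-preserving map above it is a
    homomorphism; this is Sikorski's extension theorem, by Zorn's lemma. *)

Set Implicit Arguments.
Unset Strict Implicit.
Local Open Scope order_scope.

Lemma sval_injective (A : Type) (P : A -> Prop) :
  injective (fun x : {a | P a} => sval x).
Proof.
by move=> [a Pa] [b Pb] /= ab; exact: eq_exist.
Qed.

(** * Suprema and deciding elements in Boolean algebras *)

Section BooleanAlgebra.
Context {d : Order.disp_t} {B : ctbDistrLatticeType d}.
Implicit Types (b c x y z : B) (S : set B).

Lemma leIx_compl x b z : (x `&` b <= z) = (x <= z `|` ~` b).
Proof.
by rewrite -{1}(complK b) -diffE leBLR joinC.
Qed.

(** Meeting with [b] is left adjoint to joining with its complement, so it commutes with every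
    existing supremum. *)
Lemma supremum_meet_le S s b z :
  supremums S s -> (forall x, S x -> x `&` b <= z) -> s `&` b <= z.
Proof.
case=> _ sle Sz; rewrite leIx_compl; apply: sle => x Sx.
by rewrite -leIx_compl; exact: Sz.
Qed.

(** One decision at a time: [x] is replaced by its meet with [b], unless that is zero and [x]
    already lies below the complement of [b]. *)
Lemma exists_le_decides (l : seq B) x :
  \bot < x -> exists2 c, c <= x & \bot < c /\ forall b, b \in l -> decides c b.
Proof.
elim: l x => [|b l IHl] x x0; first by exists x.
have [y [yx y0 yb]] : exists y, [/\ y <= x, \bot < y & y <= b \/ y <= ~` b].
  have [xb|xb] := eqVneq (x `&` b) \bot.
    by exists x; split=> //; right; rewrite -disj_leC xb.
  by exists (x `&` b); rewrite leIl lt0x leIr; split=> //; left.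
have [c cy [c0 cl]] := IHl y y0.
exists c; first exact: le_trans yx.
split=> // b'; rewrite inE => /predU1P[->|/cl//].
by split=> //; case: yb => yb; [left|right]; exact: le_trans yb.
Qed.

(** Elements deciding a finite list are dense, so a failure of [x <= z] would show on one of them
    below the nonzero difference of [x] and [z]. *)
Lemma le_deciding (l : seq B) x z :
  (forall c, c <= x -> \bot < c -> (forall b, b \in l -> decides c b) ->
     c <= z) ->
  x <= z.
Proof.
move=> xz; have [x0|xz0] := eqVneq (x `&` ~` z) \bot.
  by rewrite -[z]complK -disj_leC x0.
have [|c cxz [c0 cl]] := @exists_le_decides l (x `&` ~` z); first by rewrite lt0x.
have /andP[cx cz] : (c <= x) && (c <= ~` z) by rewrite -lexI.
by have := c0; rewrite lt0x -lex0 -(meetxC z) lexI cz (xz c).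
Qed.

End BooleanAlgebra.

(** * Extension of meet-preserving maps to homomorphisms *)

Section Extension.
Context {d d' : Order.disp_t} {D : ctbDistrLatticeType d}
  {B : ctbDistrLatticeType d'}.

(** Complements are left out because pointwise comparable homomorphisms are equal, which would leave
    Zorn's lemma no room. *)
Record proper_meet_morphism (g : D -> B) : Prop := {
  pmm_bot : g \bot = \bot;
  pmm_top : g \top = \top;
  pmm_meet : forall x y, g (x `&` y) = g x `&` g y }.

Lemma pmm_mono g : proper_meet_morphism g -> {homo g : x y / x <= y}.
Proof. by move=> gP x y /meet_idPl<-; rewrite pmm_meet// leIr. Qed.

(* The raised map equals g on g b and g (b `|` x) off it, so it sends the
   complement of b above that of g b: a maximal g preserves complements. *)
Lemma pmm_raise g (b : D) : proper_meet_morphism g ->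
  proper_meet_morphism
    (fun x => (g b `&` g x) `|` (~` (g b) `&` g (b `|` x))).
Proof.
move=> gP; split=> [||x y].
- by rewrite pmm_bot// meetx0 joinx0 join0x meetCx.
- by rewrite joinx1 pmm_top// !meetx1 joinxC.
- rewrite (joinIr b) !pmm_meet// [RHS]meetUl !meetUr.
  rewrite [_ `&` _ `&` (~` _ `&` _)]meetACA meetxC meet0x joinx0.
  rewrite [~` _ `&` _ `&` (g b `&` _)]meetACA meetCx meet0x join0x.
  by congr (_ `|` _); rewrite [RHS]meetACA meetxx.
Qed.

(** For binary meets, the values at [x] and [y] come from two members of the chain; the larger one
    bounds both and preserves the meet. *)
Lemma pmm_supremum (F : set (D -> B)) (g : D -> B) :
  (F !=set0)%classic -> (forall f, F f -> proper_meet_morphism f) ->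
  total_on F (fun f h => forall x, f x <= h x) ->
  (forall x, supremums [set f x | f in F]%classic (g x)) ->
  proper_meet_morphism g.
Proof.
move=> [f0 Ff0] FP tot gsup.
have ub f x : F f -> f x <= g x by move=> Ff; apply: (gsup x).1; exists f.
have lb x z : (forall f, F f -> f x <= z) -> g x <= z.
  by move=> H; apply: (gsup x).2 => _ [f Ff <-]; exact: H.
split=> [||x y].
- by apply/eqP; rewrite -lex0; apply: lb => f /FP /pmm_bot ->.
- by apply/eqP; rewrite -le1x -(pmm_top (FP _ Ff0)) ub.
apply/eqP; rewrite eq_le lexI -andbA; apply/and3P; split.
- by apply: lb => f Ff; rewrite (le_trans _ (ub _ _ Ff))// (pmm_mono (FP _ Ff))// leIl.
- by apply: lb => f Ff; rewrite (le_trans _ (ub _ _ Ff))// (pmm_mono (FP _ Ff))// leIr.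
apply: (supremum_meet_le (gsup x)) => /= _ [f Ff <-]; rewrite meetC.
apply: (supremum_meet_le (gsup y)) => _ [h Fh <-].
have [fh|hf] := tot _ _ Ff Fh.
- by rewrite (le_trans _ (ub _ _ Fh))// (pmm_meet (FP _ Fh)) meetC leI2.
- by rewrite (le_trans _ (ub _ _ Ff))// (pmm_meet (FP _ Ff)) meetC leI2.
Qed.

Lemma pmm_extension (g0 : D -> B) : complete_lattice B ->
  proper_meet_morphism g0 ->
  exists g : D -> B, [/\ proper_meet_morphism g, forall x, g0 x <= g x &
    forall x, g (~` x) = ~` (g x)].
Proof.
move=> Bc g0P.
pose X := {g : D -> B | proper_meet_morphism g /\ forall x, g0 x <= g x}.
pose R : rel X := fun g h => `[< forall x, sval g x <= sval h x >].
have [|g h k /asboolP gh /asboolP hk|g h /asboolP gh /asboolP hg|F tot|g gmax] :=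
  @Zorn X R.
- by move=> g; apply/asboolP.
- by apply/asboolP => x; exact: le_trans (gh x) (hk x).
- by apply: sval_injective; apply/funext => x; apply/le_anti; rewrite gh hg.
- have [F0|/set0P[f0 Ff0]] := eqVneq F set0.
    by exists (exist _ g0 (conj g0P (fun=> lexx _))) => h; rewrite F0.
  have [s sP] := choice (fun x => Bc [set f x | f in [set sval f | f in F]]%classic).
  have spmm : proper_meet_morphism s.
    apply: pmm_supremum sP => [|_ [f _ <-]|_ _ [f Ff <-] [h Fh <-]].
    + by exists (sval f0); exists f0.
    + by case: f => f [].
    + by case: (tot _ _ Ff Fh) => /asboolP; [left|right].
  have sub f x : F f -> sval f x <= s x.
    by move=> Ff; apply: (sP x).1; exists (sval f) => //; exists f.
  have s0 x : g0 x <= s x.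
    by apply: le_trans (sub f0 x Ff0); case: (f0) => ? [].
  exists (exist _ s (conj spmm s0)) => f Ff.
  by apply/asboolP => x; exact: sub.
case: g gmax => g [gP g0g] gmax; exists g; split=> // b.
pose g' x := (g b `&` g x) `|` (~` (g b) `&` g (b `|` x)).
have gg' x : g x <= g' x.
  rewrite -[g x]meet1x -(joinxC (g b)) meetUl leU2// leI2//.
  by rewrite pmm_mono// leUr.
have g'P : proper_meet_morphism g' /\ forall x, g0 x <= g' x.
  by split=> [|x]; [exact: pmm_raise|exact: le_trans (gg' x)].
have /(congr1 sval)/= g'E : exist _ g' g'P = exist _ g (conj gP g0g) :> X.
  by apply: gmax; apply/asboolP.
(* By maximality the map raised at [b] is [g] itself; at the complement of [b] its second term is
   the complement of [g b]. *)
apply/eqP; rewrite eq_le -disj_leC -pmm_meet// meetCx pmm_bot// eqxx /=.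
by rewrite -[in X in _ <= X]g'E /g' joinxC (pmm_top gP) meetx1 leUr.
Qed.

End Extension.

(** * Ultrafilters and quotients *)

Lemma complete_lattice_bool : complete_lattice bool.
Proof.
move=> S; exists `[< S true >]; split=> [[] Sx|[] ub]; rewrite ?le0x ?lex1//.
- by rewrite asboolT.
- by case: asboolP => // /ub.
Qed.

Record ultrafilter {d : Order.disp_t} (B : ctbDistrLatticeType d)
    (U : B -> Prop) : Prop := {
  ultra_top : U \top;
  ultra_meet : forall x y, U (x `&` y) <-> U x /\ U y;
  ultra_compl : forall x, U (~` x) <-> ~ U x }.

(** The principal filter of [c], read as a map to [bool], preserves meets; a homomorphism above it
    is an ultrafilter containing [c]. *)
Lemma ultrafilter_exists {d : Order.disp_t} (B : ctbDistrLatticeType d)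
    (c : B) : \bot < c -> exists U : B -> Prop, U c /\ ultrafilter U.
Proof.
move=> c0.
have [|g [gP cg gC]] := @pmm_extension _ _ B bool (>= c) complete_lattice_bool.
  by split=> [||x y]; rewrite ?lex1 ?lexI// lex0; apply/negbTE; rewrite -lt0x.
exists (fun x => is_true (g x)); split; last split=> [|x y|x].
- by have := cg c; rewrite lexx; case: (g c).
- by rewrite (pmm_top gP).
- by rewrite (pmm_meet gP); apply: iff_sym; exact: rwP andP.
- by rewrite gC; apply: iff_sym; exact: rwP negP.
Qed.

Lemma quotient_exists (T : Type) (E : T -> T -> Prop) :
  (forall a, E a a) -> (forall a b, E a b -> E b a) ->
  (forall a b c, E a b -> E b c -> E a c) ->
  exists (Q : Type) (cls : T -> Q) (repr : Q -> T),
    cancel repr cls /\ forall a b, cls a = cls b <-> E a b.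
Proof.
move=> Er Es Et; pose Q := {P : set T | exists a, P = E a}.
exists Q, (fun a => exist _ (E a) (ex_intro _ a erefl)),
  (fun q : Q => sval (cid (svalP q))).
split=> [[P PE]|a b].
  by apply: sval_injective => /=; case: cid => /= a ->.
split=> [/(congr1 sval)/= ->|Eab]; first exact: Er.
apply: sval_injective; apply/funext => c; apply/propext.
by split; apply: Et => //; exact: Es.
Qed.

(** * Satisfaction under renaming, tuple quantifiers and finite conjunctions *)

Section Satisfaction.
Context {L : language}.
Implicit Type M : structure L.

Lemma eq_sat M V (e e' : V -> M) (p : formula L V) :
  e =1 e' -> sat e p -> sat e' p.
Proof. by move=> /funext ->. Qed.

Lemma teval_map M V W (h : V -> W) (e : W -> M) (t : term L V) :
  teval e (term_map h t) = teval (e \o h) t.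
Proof.
elim: t => [v|f ts IHt] //=; congr finterp; apply/funext => k; exact: IHt.
Qed.

Lemma sat_map M V W (h : V -> W) (e : W -> M) (p : formula L V) :
  sat e (formula_map h p) <-> sat (e \o h) p.
Proof.
elim: p W h e => {V} [V|V t u|V r ts|V p IHp|V p IHp q IHq|V p IHp] W h e /=.
- by [].
- by rewrite !teval_map.
- rewrite (_ : (fun k => _) = (fun k => teval (e \o h) (ts k)))//.
  by apply/funext => k; rewrite teval_map.
- by rewrite IHp.
- by rewrite IHp IHq.
- have envE a : (fun o => if o is Some v then e v else a) \o omap h =
      (fun o => if o is Some v then (e \o h) v else a).
    by apply/funext; case.
  by split=> -[a pa]; exists a; move: pa; rewrite IHp envE.
Qed.

Lemma sat_inst M V (e : V -> M) (p : formula L (option V)) (a : V) :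
  sat e (f_inst p a) <-> sat (fun o => if o is Some v then e v else e a) p.
Proof. by rewrite sat_map; split; apply: eq_sat => -[]. Qed.

Definition tuple_env (n : nat) (V W : Type) (x : 'I_n -> W) (e : V -> W)
    (u : 'I_n + V) : W :=
  match u with inl i => x i | inr v => e v end.

Lemma sat_exs M n V (e : V -> M) (p : formula L ('I_n + V)) :
  sat e (f_exs p) <-> exists x, sat (tuple_env x e) p.
Proof.
elim: n V e p => [|n IHn] V e p /=.
  rewrite sat_map; split=> [pe|[x]].
    have x0 : 'I_0 -> M by case.
    exists x0.
    by apply: eq_sat pe => -[[]|].
  by apply: eq_sat => -[[]|].
rewrite IHn /=; split=> [[x [a]]|[x px]].
  rewrite sat_map => pa.
  exists (fun i => if unlift ord0 i is Some j then x j else a).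
  by apply: eq_sat pa => -[i|v] //=; case: unlift.
exists (x \o lift ord0), (x ord0); rewrite sat_map.
apply: eq_sat px => -[i|v] //=.
by case: unliftP => [j|] ->.
Qed.

Lemma sat_big_and M V (e : V -> M) (J : eqType) (r : seq J)
    (F : J -> formula L V) :
  sat e (\big[f_and/f_true]_(i <- r) F i) <-> forall i, i \in r -> sat e (F i).
Proof.
elim: r => [|j r IHr]; rewrite ?big_nil// big_cons /= IHr.
split=> [[Fj Fr] i|H]; first by rewrite inE => /predU1P[->//|]; exact: Fr.
by split=> [|i ir]; apply: H; rewrite inE ?eqxx// ir orbT.
Qed.

Lemma sat_ex_conj (I : choiceType) (phi : formula_seq L I) M V (e : V -> M)
    (a : forall i, (ylen phi i).-tuple V) (s : {fset I}) :
  sat e (ex_conj a s) <->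
  exists x, forall i, i \in s ->
    sat (tuple_env x (fun k => e (tnth (a i) k))) (phi i).
Proof.
rewrite sat_exs; split=> -[x H]; exists x.
  by move/sat_big_and: H => H i /H /sat_map; apply: eq_sat => -[].
by apply/sat_big_and => i /H xi; apply/sat_map; apply: eq_sat xi => -[].
Qed.

(** Agreement is asked only on [s]: in a product it can be secured for finitely many indices at a
    time. *)
Lemma eq_sat_ex_conj (I : choiceType) (phi : formula_seq L I) M V V'
    (e : V -> M) (e' : V' -> M) (a : forall i, (ylen phi i).-tuple V)
    (a' : forall i, (ylen phi i).-tuple V') (s : {fset I}) :
  (forall i, i \in s -> forall k, e (tnth (a i) k) = e' (tnth (a' i) k)) ->
  sat e (ex_conj a s) <-> sat e' (ex_conj a' s).
Proof.
move=> aa'; rewrite !sat_ex_conj; split=> -[x H]; exists x => i si; have := H i si;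
  by apply: eq_sat => -[j|k] //=; rewrite aa'.
Qed.

Lemma ex_conj_anti (I : choiceType) (phi : formula_seq L I) M V (e : V -> M)
    (a : forall i, (ylen phi i).-tuple V) (s t : {fset I}) :
  (s `<=` t)%fset -> sat e (ex_conj a t) -> sat e (ex_conj a s).
Proof.
move=> /fsubsetP st; rewrite !sat_ex_conj => -[x H].
by exists x => i /st; exact: H.
Qed.

End Satisfaction.

(** * Boolean-valued products *)

Section ProductStructure.
Context {d : Order.disp_t} {B : ctbDistrLatticeType d} {L : language}.
Context {K : Type} (N : K -> structure L) (h : set K -> B).
Context (hP : proper_meet_morphism h) (hC : forall x, h (~` x) = ~` (h x)).

Lemma pmm_forall_top (J : eqType) (r : seq J) (F : J -> set K) :
  (forall i, i \in r -> h (F i) = \top) ->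
  h [set k | forall i, i \in r -> F i k]%classic = \top.
Proof.
elim: r => [|j r IHr] hF.
  by rewrite -(pmm_top hP); congr h; apply/funext => k; apply/propext.
rewrite -[RHS](meet1x \top) -{1}(hF j) ?mem_head//.
rewrite -IHr => [|i ir]; last by rewrite hF// inE ir orbT.
rewrite -pmm_meet//; congr h; apply/funext => k; apply/propext; split=> [H|[Fj Fr] i].
  by split=> [|i ir]; apply: H; rewrite inE ?eqxx// ir orbT.
by rewrite inE => /predU1P[->//|]; exact: Fr.
Qed.

Lemma product_structure_exists :
  exists (M : bv_structure B L) (cls : (forall k, N k) -> M)
    (repr : M -> forall k, N k),
    [/\ cancel repr cls,
        forall a b, cls a = cls b -> h [set k | a k = b k]%classic = \top &
        forall p, bv_val p = h [set k | sat (repr^~ k) p]%classic].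
Proof.
(* Identifying functions that are equal with value [\top] is what yields [bv_neq]. *)
pose E (a b : forall k, N k) := h [set k | a k = b k]%classic = \top.
have hle (X Y : set K) : (forall k, X k -> Y k) -> h X <= h Y.
  by move=> XY; apply: pmm_mono => //; rewrite subsetEset.
have htop (X : set K) : (forall k, X k) -> h X = \top.
  by move=> XT; apply/eqP; rewrite -le1x -(pmm_top hP); exact: hle.
have [|a b ab|a b c ab bc|Q [cls [repr [reprK clsE]]]] := @quotient_exists _ E.
- by move=> a; exact: htop.
- by rewrite /E -ab; congr h; apply/funext => k; apply/propext; split.
- apply/eqP; rewrite -le1x -(meet1x \top) -{1}ab -bc -pmm_meet//.
  by apply: hle => k [/= -> ->].
pose bval (p : formula L Q) := h [set k | sat (repr^~ k) p]%classic.
have val_inst p a : bval (f_inst p a) <= bval (f_ex p).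
  by apply: hle => k; rewrite /= sat_inst => pa; exists (repr a k).
have full p : exists a, bval (f_ex p) = bval (f_inst p a).
  pose P k (w : N k) := sat (fun o => if o is Some v then repr v k else w) p.
  (* Fullness comes from choosing witnesses coordinatewise. *)
  have [w wP] : exists w : forall k, N k, forall k, (exists v, P k v) -> P k (w k).
    have w0 k : exists v, (exists v, P k v) -> P k v.
      have [[v Pv]|nP] := pselect (exists v, P k v); first by exists v.
      by have [v] := carrier_inh (N k); exists v.
    by exists (fun k => sval (cid (w0 k))) => k; case: cid.
  exists (cls w); apply/le_anti; rewrite val_inst andbT.
  (* The representative of [cls w] agrees with [w] on a set of value [\top]; meeting with that set
     leaves the value unchanged. *)
  have /clsE wE := reprK (cls w).
  rewrite -[leLHS]meet1x -wE -pmm_meet//; apply: hle => k [/= wk /wP].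
  by rewrite sat_inst wk.
have sup p : supremums (range (fun a => bval (f_inst p a))) (bval (f_ex p)).
  split=> [_ [a _ <-]//|y ub]; have [a ->] := full p.
  by apply: ub; exists a.
have vvalid p : valid p -> bval p = \top by move=> vp; apply: htop => k; exact: vp.
have vnot p : bval (f_not p) = ~` (bval p) by rewrite -hC.
have vand p q : bval (f_and p q) = bval p `&` bval q by rewrite -pmm_meet.
have vneq a b : a <> b -> bval (f_eq (tvar a) (tvar b)) < \top.
  move=> ab; rewrite lt_neqAle lex1 andbT; apply/eqP => /clsE.
  by rewrite !reprK.
by exists (BVStructure vvalid vnot vand sup vneq full), cls, repr; split=> // a b /clsE.
Qed.

End ProductStructure.

(** * Two-valued quotients by ultrafilters *)

Section Ultraquotient.
Context {d : Order.disp_t} {B : ctbDistrLatticeType d} {L : language}.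
Context (M : bv_structure B L).

Lemma bv_val_le (p q : formula L M) :
  (forall (N : structure L) (e : M -> N), sat e p -> sat e q) ->
  bv_val p <= bv_val q.
Proof.
move=> pq; have /bv_valid : valid (f_not (f_and p (f_not q))).
  by move=> N e /= [/pq].
rewrite bv_not bv_and bv_not => /(congr1 Order.compl).
by rewrite complK compl1 => /eqP; rewrite disj_leC complK.
Qed.

Context (U : B -> Prop) (UP : ultrafilter U).

Lemma ultra_le x y : x <= y -> U x -> U y.
Proof. by move=> /meet_idPl <-; rewrite (ultra_meet UP) => -[]. Qed.

(** The finite family [P] holds the equations for all arguments of a function or relation symbol at
    once. *)
Lemma ultra_consequence n (P : 'I_n -> formula L M) (p q : formula L M) :
  (forall k, U (bv_val (P k))) -> U (bv_val p) ->
  (forall (N : structure L) (e : M -> N),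
     (forall k, sat e (P k)) -> sat e p -> sat e q) ->
  U (bv_val q).
Proof.
move=> UPk Up Pq.
apply: (@ultra_le (bv_val (f_and (\big[f_and/f_true]_k P k) p))).
  apply: bv_val_le => N e [/sat_big_and Pe]; apply: Pq => k.
  by apply: Pe; rewrite mem_index_enum.
rewrite bv_and (ultra_meet UP); split=> //.
apply: (big_ind (fun p => U (bv_val p))) => // [|p' p'' Up' Up''].
  by rewrite bv_valid//; exact: ultra_top.
by rewrite bv_and (ultra_meet UP).
Qed.

Lemma ultra_consequence1 (p q : formula L M) :
  U (bv_val p) ->
  (forall (N : structure L) (e : M -> N), sat e p -> sat e q) -> U (bv_val q).
Proof. by move=> Up pq; apply: ultra_le Up; exact: bv_val_le. Qed.

Lemma ultra_consequence2 (p p' q : formula L M) :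
  U (bv_val p) -> U (bv_val p') ->
  (forall (N : structure L) (e : M -> N), sat e p -> sat e p' -> sat e q) ->
  U (bv_val q).
Proof.
move=> Up Up' pq; apply: (@ultra_consequence 1 (fun=> p) p' q) => // N e pe.
by apply: pq; exact: pe ord0.
Qed.

Lemma ultra_valid (p : formula L M) : valid p -> U (bv_val p).
Proof. by move=> /bv_valid ->; exact: ultra_top. Qed.

Lemma ultraquotient_exists :
  exists (N : structure L) (cls : M -> N),
    forall V (e : V -> M) (p : formula L V),
      sat (cls \o e) p <-> U (bv_val (formula_map e p)).
Proof.
pose E (a b : M) := U (bv_val (f_eq (tvar a) (tvar b))).
have [|a b ab|a b c ab bc|Q [cls [repr [reprK clsE]]]] := @quotient_exists _ E.
- by move=> a; exact: ultra_valid.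
- by apply: ultra_consequence1 ab _ => N e /= ->.
- by apply: ultra_consequence2 ab bc _ => N e /= -> ->.
have inhQ : inhabited Q.
  by have [a _] := bv_full (f_true : formula L (option M)); split; exact: cls a.
(* That an application of [f] has a value is valid, so fullness supplies an element naming it. *)
have fval (f : funsym L) (a : 'I_(fun_arity f) -> Q) : exists b : M,
    U (bv_val (f_eq (tvar b) (tapp f (fun k => tvar (repr (a k)))))).
  pose p : formula L (option M) :=
    f_eq (tvar None) (tapp f (fun k => tvar (Some (repr (a k))))).
  have [b bE] := bv_full p; exists b; rewrite -[f_eq _ _]/(f_inst p b) -bE.
  by apply: ultra_valid => N e /=; eexists.
pose N := @Structure L Q inhQ (fun f a => cls (sval (cid (fval f a))))
  (fun r a => U (bv_val (f_rel r (fun k => tvar (repr (a k)))))).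
pose c : M -> N := cls; have cK (a : N) : c (repr a) = a by exact: reprK.
exists N, c.
(* Modulo [U], every term equals the representative of its value in the quotient; the atomic cases
   rest on this. *)
have tevalE V (e : V -> M) (t : term L V) :
    U (bv_val (f_eq (term_map e t) (tvar (repr (teval (c \o e) t))))).
  elim: t => [v|f ts IHt] /=; first by apply/clsE/esym; exact: cK.
  set b := sval _; have Ub : U (bv_val (f_eq (tvar b)
      (tapp f (fun k => tvar (repr (teval (c \o e) (ts k))))))).
    by rewrite /b; case: cid.
  have /clsE Ubb : c b = c (repr (c b)) by rewrite cK.
  have Utb : U (bv_val (f_eq (tapp f (fun k => term_map e (ts k))) (tvar b))).
    apply: ultra_consequence IHt Ub _ => N' e' /= tsE ->.
    by congr finterp; apply/funext.
  by apply: ultra_consequence2 Utb Ubb _ => N' e' /= -> ->.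
move=> V e p; elim: p e => {V} [V|V t u|V r ts|V p IHp|V p IHp q IHq|V p IHp] e /=.
- by split=> // _; exact: ultra_valid.
- have [Ut Uu] := (tevalE V e t, tevalE V e u); split=> [tu|Utu].
    by rewrite tu in Ut; apply: ultra_consequence2 Ut Uu _ => N' e' /= -> ->.
  rewrite -[LHS]cK -[RHS]cK.
  apply/clsE; apply: (@ultra_consequence 2
    (fun k => if val k == 0 then f_eq (term_map e t) (tvar (repr (teval (c \o e) t)))
     else f_eq (term_map e u) (tvar (repr (teval (c \o e) u)))) _ _ _ Utu).
    by move=> k; case: ifP.
  by move=> N' e' H /=; rewrite (H ord0) (H ord_max).
- have Uts k := tevalE V e (ts k).
  split=> Ur; apply: ultra_consequence Uts Ur _ => N' e' /= /funext tsE;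
    by rewrite tsE.
- by rewrite IHp bv_not (ultra_compl UP).
- by rewrite IHp IHq bv_and (ultra_meet UP).
(* Every point of the quotient is some [c b], so the quantifier is tested on instances; fullness
   provides the one that attains its value. *)
have inst b : sat (fun o => if o is Some v then (c \o e) v else c b) p <->
    U (bv_val (f_inst (formula_map (omap e) p) b)).
  have -> : (fun o => if o is Some v then (c \o e) v else c b) =
      (c \o (fun o => if o is Some v then e v else b) ).
    by apply/funext => -[].
  rewrite IHp; split; apply: ultra_le; apply: bv_val_le => N' e';
    by rewrite !sat_map; apply: eq_sat => -[].
split=> [[a]|].
  rewrite -[a]cK => /inst Up.
  apply: ultra_consequence1 Up _ => N' e'.
  by rewrite sat_inst; exists (e' (repr a)).
by have [b ->] := bv_full (formula_map (omap e) p); move/inst => pb; exists (c b).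
Qed.

End Ultraquotient.
Lemma decided_ex_conj_realized {d : Order.disp_t} (B : ctbDistrLatticeType d)
    (L : language) (T : theory L) (I : choiceType) (phi : formula_seq L I)
    (M : bv_structure B L) (a : forall i, (ylen phi i).-tuple M) (c : B) :
  bv_models M T -> \bot < c ->
  exists (N : structure L) (b : forall i, (ylen phi i).-tuple N),
    models N T /\
    forall t : {fset I},
      (c <= bv_val (ex_conj a t) -> holds (ex_conj b t)) /\
      (c <= ~` bv_val (ex_conj a t) -> ~ holds (ex_conj b t)).
Proof.
move=> MT /ultrafilter_exists[U [Uc UP]].
have [N [cls clsP]] := ultraquotient_exists M UP.
exists N, (fun i => map_tuple cls (a i)); split=> [p Tp|t].
  have : U (bv_val (formula_map (of_void M) p)) by rewrite MT//; exact: ultra_top.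
  by move=> /clsP; apply: eq_sat => -[].
have holdsE : holds (ex_conj (fun i => map_tuple cls (a i)) t) <->
    U (bv_val (ex_conj a t)).
  apply: iff_trans (_ : sat (cls \o id) (ex_conj a t) <-> _).
    by apply: eq_sat_ex_conj => i _ k; rewrite tnth_map.
  rewrite clsP; split; apply: ultra_le => //; apply: bv_val_le => N' e;
    by rewrite sat_map; apply: eq_sat.
split=> cv; rewrite holdsE.
  exact: ultra_le cv Uc.
by apply/(ultra_compl UP); exact: ultra_le cv Uc.
Qed.

(** * A homomorphism forced by the constraints *)

Section ConstrainedMorphism.
Context {d : Order.disp_t} {B : ctbDistrLatticeType d} {I : choiceType}.
Context {K : Type} (A : distribution B I) (S : {fset I} -> set K).

(* The constraints that c, if it decides A on the subsets of s, imposes on a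
   model: it lies in S t for c <= A t, and outside it for c <= C t minus A t. *)
Definition conforms (s : {fset I}) (c : B) : set K :=
  fun k => forall t, (t `<=` s)%fset ->
    (c <= A t -> S t k) /\
    (c <= ~` A t -> c <= \meet_(i <- t) A [fset i]%fset -> ~ S t k).

Definition decides_below (s : {fset I}) (c : B) : Prop :=
  forall t, (t `<=` s)%fset -> decides c (A t).

(** Enlarging [s] adds constraints, and shrinking [c] makes more of their premises true. *)
Lemma conforms_le s s' c c' : (s `<=` s')%fset -> c' <= c ->
  conforms s' c' <= conforms s c.
Proof.
move=> ss' c'c; rewrite subsetEset => k kP t ts.
have [kS kN] := kP t (fsubset_trans ts ss').
by split=> [/(le_trans c'c)/kS//|/(le_trans c'c) cN /(le_trans c'c)]; exact: kN.
Qed.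

Lemma constrained_morphism_exists :
  complete_lattice B ->
  (forall s c, decides_below s c -> exists k, conforms s c k) ->
  exists h : set K -> B,
    [/\ proper_meet_morphism h, forall X, h (~` X) = ~` (h X),
        forall t, A t <= h (S t) &
        forall t, h (S t) `&` \meet_(i <- t) A [fset i]%fset <= A t].
Proof.
move=> Bc consistent.
(* [D X] collects the conditions [c] whose constraints force [X]; its supremum [g X] is the value
   forced on [X]. *)
pose D (X : set K) : set B :=
  fun c => exists s, decides_below s c /\ conforms s c <= X.
have [g gsup] := choice (fun X => Bc (D X)).
have ub X c : D X c -> c <= g X by exact: (gsup X).1.
(* By density, only those [c] below [x] that decide [A] on the finitely many subsets of [s] need be
   tested. *)
have g_le s X x :
    (forall c, c <= x -> decides_below s c -> conforms s c <= X) -> x <= g X.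
  move=> H; apply: (le_deciding (l := [seq A t | t <- fpowerset s])) => c cx c0 cd.
  have cs : decides_below s c.
    by move=> t ts; apply: cd; apply: map_f; rewrite fpowersetE.
  by apply: ub; exists s; split=> //; exact: H.
have gmono : {homo g : X Y / X <= Y}.
  move=> X Y XY; apply: (gsup X).2 => c [s [cs sX]].
  by apply: ub; exists s; split=> //; exact: le_trans sX XY.
have gP : proper_meet_morphism g.
  split=> [||X Y].
  - apply/eqP; rewrite -lex0; apply: (gsup _).2 => c [s [cs]].
    by have [k kP] := consistent s c cs; rewrite subsetEset => /(_ k kP).
  - apply/eqP; rewrite -le1x; apply: (g_le fset0) => c _ _; exact: lex1.
  apply/eqP; rewrite eq_le lexI !gmono ?leIl ?leIr//=.
  apply: (supremum_meet_le (gsup X)) => c [s [_ sX]]; rewrite meetC.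
  apply: (supremum_meet_le (gsup Y)) => c' [s' [_ sY]].
  (* A condition below both [c] and [c'] that decides [A] on the union forces both [X] and [Y]. *)
  apply: (g_le (s `|` s')%fset) => e; rewrite lexI => /andP[ec' ec] _.
  rewrite lexI (le_trans _ sX) ?(le_trans _ sY)//; apply: conforms_le => //;
    by rewrite ?fsubsetUl ?fsubsetUr.
have [h [hP gh hC]] := pmm_extension Bc gP.
exists h; split=> // t.
  apply: le_trans (gh _); apply: (g_le t) => c ct _; rewrite subsetEset => k.
  by move=> /(_ t (fsubset_refl t))[/(_ ct)].
(* In complements: the meet of the [A {i}] minus [A t] lies below the value of the complement of
   [S t], which [g] already forces. *)
rewrite leIx_compl -leC complU complK -hC; apply: le_trans (gh _).
apply: (g_le t) => c; rewrite lexI => /andP[cA cm] _; rewrite subsetEset => k.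
by move=> /(_ t (fsubset_refl t))[_]; exact.
Qed.

End ConstrainedMorphism.

(** * The product of the given models, and the equivalence *)

Lemma product_ex_conj {d : Order.disp_t} {B : ctbDistrLatticeType d}
    {L : language} {K : Type} (N : K -> structure L) (h : set K -> B)
    (T : theory L) (I : choiceType) (phi : formula_seq L I)
    (a : forall k i, (ylen phi i).-tuple (N k)) :
  proper_meet_morphism h -> (forall X, h (~` X) = ~` (h X)) ->
  (forall k, models (N k) T) ->
  exists (M : bv_structure B L) (b : forall i, (ylen phi i).-tuple M),
    bv_models M T /\
    forall s : {fset I},
      bv_val (ex_conj b s) = h [set k | holds (ex_conj (a k) s)]%classic.
Proof.
move=> hP hC NT.
have [M [cls [repr [reprK clsE valE]]]] := product_structure_exists N hP hC.
pose w i j : forall k, N k := fun k => tnth (a k i) j.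
exists M, (fun i => [tuple cls (w i j) | j < ylen phi i]); split=> [p Tp|s].
  rewrite valE -(pmm_top hP); congr h; apply/funext => k; apply/propext.
  split=> // _; apply/sat_map; apply: eq_sat (NT k p Tp) => -[].
(* [F i] is where the representatives of the classes return the chosen tuple; its value is [\top],
   and so is that of the intersection over the finite [s]. *)
pose F i : set K := [set k | forall j, repr (cls (w i j)) k = w i j k]%classic.
have F1 i : h (F i) = \top.
  rewrite -(@pmm_forall_top _ _ _ _ hP _ (index_enum 'I_(ylen phi i))
    (fun j => [set k | repr (cls (w i j)) k = w i j k]%classic)); last first.
    by move=> j _; apply: clsE; rewrite reprK.
  congr h; apply/funext => k; apply/propext; split=> H j => [_|]; first exact: H.
  by apply: H; rewrite mem_index_enum.
pose F' : set K := [set k | forall i, i \in s -> F i k]%classic.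
have Fs : h F' = \top by apply: pmm_forall_top.
rewrite valE -[LHS]meet1x -[RHS]meet1x -Fs -!pmm_meet//; congr h.
apply/funext => k; apply/propext.
have bE : F' k ->
    sat (repr^~ k) (ex_conj (fun i => [tuple cls (w i j) | j < ylen phi i]) s) <->
    sat id (ex_conj (a k) s).
  by move=> Fk; apply: eq_sat_ex_conj => i si j; rewrite tnth_mktuple Fk.
by split=> -[Fk sk]; split=> //; apply/(bE Fk).
Qed.

Unset Implicit Arguments.

Theorem theorem5p3 (d : Order.disp_t) (B : ctbDistrLatticeType d)
    (L : language) (T : theory L) (I : choiceType) (A : distribution B I)
    (phi : formula_seq L I) :
  complete_lattice B ->
  countable_language L ->
  complete_theory T ->
  possibility T phi A <->
  (forall (s : {fset I}) (c : B),
     \bot < c ->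
     (forall t : {fset I}, (t `<=` s)%fset -> decides c (A t)) ->
     (forall i : I, i \in s -> c <= A [fset i]%fset) ->
     exists (M : structure L) (a : forall i : I, (ylen phi i).-tuple M),
       models M T /\
       (forall t : {fset I}, (t `<=` s)%fset ->
          (holds (ex_conj a t) <-> c <= A t))).
Proof.
move=> Bc _ _; split=> [[A0 [M [a [MT A0E]]] [C Cmult AE]] s c c0 cA cs|realize].
  have [N [b [NT bP]]] := decided_ex_conj_realized a MT c0.
  exists N, b; split=> // t ts; have [bt bt'] := bP t.
  have cC : c <= C t.
    rewrite Cmult; apply/meetsP_seq => i it _.
    by have := cs i (fsubsetP ts i it); rewrite AE lexI => /andP[].
  split=> [|cAt]; last by apply: bt; rewrite -A0E (le_trans cAt)// AE leIl.
  have [_ [//|cNA]] := cA t ts; move=> bh; case: bt' => //.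
  (* Below [C t] the complements of [A t] and [A0 t] coincide, since [A t] is the meet of [A0 t] and
     [C t]. *)
  rewrite -A0E; have : c <= ~` A t `&` C t by rewrite lexI cNA.
  by move=> /le_trans; apply; rewrite AE complI meetUl meetCx joinx0 leIl.
pose good (sc : {fset I} * B) := decides_below A sc.1 sc.2 /\
  forall i, i \in sc.1 -> sc.2 <= A [fset i]%fset.
have realized (k : {sc | good sc}) :
    exists (M : structure L) (a : forall i, (ylen phi i).-tuple M),
    models M T /\ forall t, (t `<=` (sval k).1)%fset ->
      (holds (ex_conj a t) <-> (sval k).2 <= A t).
  case: k => -[s c] [/= cA cs]; apply: realize => //.
  by have [] := cA fset0 (fsub0set _).
pose N k := sval (cid (realized k)).
pose a k := sval (cid (svalP (cid (realized k)))).
have NT k : models (N k) T by have [] := svalP (cid (svalP (cid (realized k)))).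
have aP k t : (t `<=` (sval k).1)%fset ->
    (holds (ex_conj (a k) t) <-> (sval k).2 <= A t).
  by have [_] := svalP (cid (svalP (cid (realized k)))); exact.
pose S t := [set k | holds (ex_conj (a k) t)]%classic.
have [|h [hP hC hge hle]] := @constrained_morphism_exists _ _ _ _ A S Bc.
  (* (B) also asks for [c <= A {i}], so the other indices are dropped from [s]. No constraint is
     lost: each one with a true premise concerns a [t] inside [s']. *)
  move=> s c cA; pose s' := [fset i in s | c <= A [fset i]%fset]%fset.
  have sub t : (t `<=` s')%fset -> (t `<=` s)%fset.
    by move=> /fsubset_trans; apply; apply/fsubsetP => i; rewrite !inE => /andP[].
  have sc : good (s', c).
    by split=> [t /sub/cA//|i]; rewrite !inE => /andP[].
  exists (exist _ (s', c) sc) => t ts; split=> [cAt|cNA cm].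
    apply/aP => //=; apply/fsubsetP => i it.
    rewrite !inE (fsubsetP ts i it)/=; apply: le_trans cAt _.
    by apply: dist_anti; rewrite fsub1set.
  have ts' : (t `<=` s')%fset.
    apply/fsubsetP => i it; rewrite !inE (fsubsetP ts i it)/=.
    by apply: le_trans cm _; exact: meets_inf_seq.
  move=> /aP -/(_ ts') /= cAt; have [+ _] := cA t ts.
  by rewrite lt0x -lex0 -(meetxC (A t)) lexI cAt cNA.
have [M [b [MT bE]]] := product_ex_conj a hP hC NT.
have le_hS t : A t <= h (S t) by exact: hge.
have hS0 : h (S fset0) = \top by apply/eqP; rewrite -le1x -(dist0 A).
have hSpos t : \bot < h (S t) := lt_le_trans (dist_pos A t) (hge t).
have hSanti s t : (s `<=` t)%fset -> h (S t) <= h (S s).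
  by move=> st; apply: pmm_mono => //; rewrite subsetEset => k; exact: ex_conj_anti.
pose m t := \meet_(i <- t) A [fset i]%fset.
have mge t : A t <= m t.
  by apply/meetsP_seq => i it _; apply: dist_anti; rewrite fsub1set.
have m0 : m fset0 = \top by apply/eqP; rewrite -le1x -(dist0 A).
have manti s t : (s `<=` t)%fset -> m t <= m s.
  by move=> /fsubsetP st; apply/meetsP_seq => i /st it _; exact: meets_inf_seq.
(* The values of [S t] under [h] form the Łoś map, and [m] is the multiplicative distribution;
   [hge], [mge] and [hle] make [A] their meet. *)
exists (Distribution hSpos hS0 hSanti).
  by exists M, b; split=> // t; rewrite bE.
exists (Distribution (fun t => lt_le_trans (dist_pos A t) (mge t)) m0 manti).
  move=> s /=; apply: eq_bigr => i _.
  by rewrite /m big_seq_fset1.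
by move=> t /=; apply/le_anti; rewrite lexI hge mge hle.
Qed.
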